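(* Let $m,n,r\ge1$ be integers, let $\sigma_r$, $\mathbb{B}_0,\mathbb{B}_1$, $\mathscr{G}(\mathcal{F})$, $\mathscr{C}$, $\mathscr{E}$ and the notion of nondefectiveness be as defined in the context. Let $\mathcal{F}\in\sigma_r$ and $d=r(n+1)-1-\dim\sigma_r$. (i) When $d=0$, if $\mathscr{G}(\mathcal{F})\cap\mathscr{C}$ does not intersect $\mathscr{E}$, then, for every $G\in\mathscr{G}(\mathcal{F})\cap\mathscr{C}$, $\varphi[G]$ is nondefective. (ii) When $d>0$, if $\mathscr{H}\subseteq\mathbb{C}^{\mathbb{B}_0\times\mathbb{B}_1}$ is a subspace of codimension $d$ such that $\mathscr{G}(\mathcal{F})\cap\mathscr{C}\cap\mathscr{H}$ does not intersect $\mathscr{E}$, then, for every $G\in\mathscr{G}(\mathcal{F})\cap\mathscr{C}\cap\mathscr{H}$, $\varphi[G]$ is nondefective.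
   Context: Tensors: $\mathtt{S}^m(\mathbb{C}^{n+1})$ is the space of symmetric tensors $\mathcal{F}=(\mathcal{F}_{i_1\ldots i_m})_{0\le i_1,\ldots,i_m\le n}$ with complex entries, $\mathbb{P}\mathtt{S}^m(\mathbb{C}^{n+1})$ its projectivization, $u^{\otimes m}$ the $m$-th symmetric tensor power of $u\in\mathbb{C}^{n+1}$. $\sigma_r\subseteq\mathbb{P}\mathtt{S}^m(\mathbb{C}^{n+1})$ is the Zariski closure of the set of classes of $(u_1)^{\otimes m}+\cdots+(u_r)^{\otimes m}$ with $u_1,\ldots,u_r\in\mathbb{C}^{n+1}$. For $k\in\mathbb{Z}$, $\mathbb{N}^n_k=\{\alpha\in\mathbb{N}^n: |\alpha|\le k\}$. For $\alpha\in\mathbb{N}^n_m$, $\mathcal{F}_\alpha:=\mathcal{F}_{i_1\ldots i_m}$ whenever $x_{i_1}\cdots x_{i_m}=x^\alpha$ with $x_0:=1$. For $p=\sum_{\alpha\in\mathbb{N}^n_m}p_\alpha x^\alpha$, $\langle p,\mathcal{F}\rangle:=\sum_{\alpha}p_\alpha\mathcal{F}_\alpha$. Monomial sets: $\mathbb{B}_0$ is the set of the first $r$ monomials in $x=(x_1,\ldots,x_n)$ in the graded lexicographic order $1, x_1,\ldots,x_n,x_1^2,x_1x_2,\ldots$ (lower degree first; in equal degree $x^\alpha$ precedes $x^\beta$ if the leftmost nonzero entry of $\alpha-\beta$ is positive). $\mathbb{B}_1:=(\mathbb{B}_0\cup x_1\mathbb{B}_0\cup\cdots\cup x_n\mathbb{B}_0)\setminus\mathbb{B}_0$.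 Write $\beta\in\mathbb{B}_0$ (resp. $\alpha\in\mathbb{B}_1$) for $x^\beta\in\mathbb{B}_0$ (resp. $x^\alpha\in\mathbb{B}_1$). For $G\in\mathbb{C}^{\mathbb{B}_0\times\mathbb{B}_1}$ and $\alpha\in\mathbb{B}_1$, $\varphi[G,\alpha]:=\sum_{\beta\in\mathbb{B}_0}G(\beta,\alpha)x^\beta-x^\alpha$ and $\varphi[G]:=(\varphi[G,\alpha])_{\alpha\in\mathbb{B}_1}$. $\mathscr{G}(\mathcal{F})$ is the set of all $G\in\mathbb{C}^{\mathbb{B}_0\times\mathbb{B}_1}$ with $\langle \varphi[G,\alpha]\cdot x^\gamma,\mathcal{F}\rangle=0$ for all $\alpha\in\mathbb{B}_1$ and all $\gamma\in\mathbb{N}^n_{m-|\alpha|}$. For $i=1,\ldots,n$, $M_{x_i}(G)\in\mathbb{C}^{\mathbb{B}_0\times\mathbb{B}_0}$ is the matrix with entries, for $\mu,\nu\in\mathbb{B}_0$ and $e_i$ the $i$-th unit vector of $\mathbb{N}^n$: $M_{x_i}(G)_{\mu,\nu}=1$ if $x_ix^\nu\in\mathbb{B}_0$ and $\mu=\nu+e_i$; $=0$ if $x_ix^\nu\in\mathbb{B}_0$ and $\mu\neq\nu+e_i$; $=G(\mu,\nu+e_i)$ if $x_ix^\nu\in\mathbb{B}_1$. $\mathscr{C}:=\{G\in\mathbb{C}^{\mathbb{B}_0\times\mathbb{B}_1}: M_{x_i}(G)M_{x_j}(G)=M_{x_j}(G)M_{x_i}(G)\ \forall\, i,j\}$; the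 elements of $\mathscr{G}(\mathcal{F})\cap\mathscr{C}$ are exactly the consistent generating matrices for $\mathcal{F}$, i.e. those $G\in\mathscr{G}(\mathcal{F})$ for which $\varphi[G]$ has $r$ complex zeros counting multiplicities. For a consistent generating matrix $G$, $\varphi[G]$ is called nondefective if it has $r$ distinct zeros in $\mathbb{C}^n$, and defective otherwise. For a square matrix $X$, $\mathrm{dis}(X)$ denotes the discriminant of the characteristic polynomial of $X$ (zero if and only if $X$ has a repeated eigenvalue). $\mathscr{E}:=\{G\in\mathbb{C}^{\mathbb{B}_0\times\mathbb{B}_1}:\mathrm{dis}(M_{x_1}(G))=\cdots=\mathrm{dis}(M_{x_n}(G))=0\}$. *)

(* Defs.v *)
From HB Require Import structures.
From mathcomp Require Import all_boot all_order all_algebra perm.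
From mathcomp Require Import boolp classical_sets reals.
From mathcomp Require Import complex mpoly.

Set Implicit Arguments.
Unset Strict Implicit.
Unset Printing Implicit Defensive.

Import Order.TTheory GRing.Theory Num.Theory.
Local Open Scope classical_set_scope.
Local Open Scope ring_scope.

(** * Symmetric tensors *)

(* Indices range over {0, ..., n} = 'I_n.+1. *)
Notation tensor K m n := {ffun m.-tuple 'I_n.+1 -> K}.

Definition is_symmetric (K : fieldType) (m n : nat) (F : tensor K m n) : Prop :=
  forall (s : 'S_m) (t : m.-tuple 'I_n.+1),
    F [tuple tnth t (s k) | k < m] = F t.

Definition tpower (K : fieldType) (m n : nat) (u : 'rV[K]_n.+1) : tensor K m n :=
  [ffun t : m.-tuple 'I_n.+1 => \prod_(k < m) u 0 (tnth t k)].

(** * The projective space of symmetric tensors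

   A point of the projective space is represented by any nonzero symmetric
   tensor in its class, and a subset of the projective space by the set of
   representatives of its points.  The homogeneous coordinates are the entries
   of the tensor; the zero loci below are stable under nonzero scaling because
   the equations are homogeneous. *)

Definition tensor_eval (K : fieldType) (m n : nat)
    (p : {mpoly K[#|{: m.-tuple 'I_n.+1}|]}) (F : tensor K m n) : K :=
  p.@[fun k => F (enum_val k)].

Definition zariski_closed (K : fieldType) (m n : nat)
    (Z : set (tensor K m n)) : Prop :=
  exists P : set {mpoly K[#|{: m.-tuple 'I_n.+1}|]},
    (forall p, P p -> exists e : nat, p \is e.-homog) /\
    Z = [set F | [/\ F != 0, is_symmetric F &
                     forall p, P p -> tensor_eval p F = 0]].

Definition zariski_closure (K : fieldType) (m n : nat)
    (A : set (tensor K m n)) : set (tensor K m n) :=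
  smallest (@zariski_closed K m n) A.

Definition irreducible_closed (K : fieldType) (m n : nat)
    (Z : set (tensor K m n)) : Prop :=
  [/\ zariski_closed Z, Z !=set0 &
      forall A B : set (tensor K m n), zariski_closed A -> zariski_closed B ->
        Z `<=` A `|` B -> Z `<=` A \/ Z `<=` B].

Definition has_chain (K : fieldType) (m n : nat)
    (X : set (tensor K m n)) (k : nat) : Prop :=
  exists Z : nat -> set (tensor K m n),
    (forall i, (i <= k)%N -> irreducible_closed (Z i) /\ Z i `<=` X) /\
    (forall i, (i < k)%N -> Z i `<` Z i.+1).

(* Dimension of a nonempty closed set X: the largest length k of a chain
   Z_0 < ... < Z_k of irreducible closed subsets of X.  The default value 0
   is never reached on such an X, where the lengths are bounded. *)
Definition zariski_dim (K : fieldType) (m n : nat)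
    (X : set (tensor K m n)) : nat :=
  xget 0%N [set k | has_chain X k /\ forall l, has_chain X l -> (l <= k)%N].

(* A vanishing sum of powers has no class in the projective space, whence the
   condition F != 0. *)
Definition sigma (K : fieldType) (m n r : nat) : set (tensor K m n) :=
  zariski_closure [set F | F != 0 /\
    exists u : 'I_r -> 'rV[K]_n.+1, F = \sum_(k < r) tpower m (u k)].

(** * The pairing of polynomials with tensors *)

(* The exponent of x_{t_1} ... x_{t_m} with x_0 := 1; the variable x_{j+1},
   for j : 'I_n, is 'X_j. *)
Definition index_mnm (m n : nat) (t : m.-tuple 'I_n.+1) : 'X_{1..n} :=
  [multinom count_mem (lift ord0 j) t | j < n].

(* F_alpha; by symmetry it does not depend on the index that is picked, which
   exists as soon as mdeg a <= m. *)
Definition tcoef (K : fieldType) (m n : nat) (F : tensor K m n)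
    (a : 'X_{1..n}) : K :=
  if [pick t : m.-tuple 'I_n.+1 | index_mnm t == a] is Some t then F t else 0.

Definition pairing (K : fieldType) (m n : nat) (p : {mpoly K[n]})
    (F : tensor K m n) : K :=
  \sum_(a <- msupp p) p@_a * tcoef F a.

(** * The monomial sets B0 and B1 *)

(* The order on 'X_{1..n} of the library cannot be used: it puts x_n before
   x_1. *)
Definition grlex_lt (n : nat) (a b : 'X_{1..n}) : bool :=
  (mdeg a < mdeg b)%N ||
  (mdeg a == mdeg b) &&
  [exists i : 'I_n,
     (b i < a i)%N && [forall j : 'I_n, (j < i)%N ==> (a j == b j)]].

Definition grlex_le (n : nat) (a b : 'X_{1..n}) : bool :=
  (a == b) || grlex_lt a b.

(* For n >= 1 there is at least one monomial in each degree, so that the first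
   r monomials have degree < r. *)
Definition B0 (n r : nat) : seq 'X_{1..n} :=
  take r (sort (@grlex_le n)
            [seq bmnm a | a <- enum {: 'X_{1..n < r}}]).

Definition B1 (n r : nat) : seq 'X_{1..n} :=
  undup [seq a <- B0 n r ++ [seq (U_(i) + b)%MM | i <- enum 'I_n, b <- B0 n r]
        | a \notin B0 n r].

(** * Generating matrices

   Rows (columns) are indexed by the positions in the list B0 (B1). *)

Definition gmatrix (K : fieldType) (n r : nat) : Type :=
  'M[K]_(size (B0 n r), size (B1 n r)).

Definition mon0 (n r : nat) (b : 'I_(size (B0 n r))) : 'X_{1..n} :=
  nth 0%MM (B0 n r) b.

Definition mon1 (n r : nat) (a : 'I_(size (B1 n r))) : 'X_{1..n} :=
  nth 0%MM (B1 n r) a.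

Definition phi (K : fieldType) (n r : nat) (G : gmatrix K n r)
    (a : 'I_(size (B1 n r))) : {mpoly K[n]} :=
  \sum_(b < size (B0 n r)) G b a *: 'X_[mon0 b] - 'X_[mon1 a].

(* The condition on c says that |c| <= m - |alpha| in the integers: there is
   no such c when |alpha| > m. *)
Definition generating (K : fieldType) (m n r : nat) (F : tensor K m n) :
    set (gmatrix K n r) :=
  [set G | forall (a : 'I_(size (B1 n r))) (c : 'X_{1..n}),
     (mdeg c + mdeg (mon1 a) <= m)%N -> pairing (phi G a * 'X_[c]) F = 0].

(* x_i x^nu lies in B0 or in B1, so that the last branch is never taken. *)
Definition mulmat (K : fieldType) (n r : nat) (G : gmatrix K n r) (i : 'I_n) :
    'M[K]_(size (B0 n r)) :=
  \matrix_(mu, nu)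
    if (mon0 nu + U_(i))%MM \in B0 n r
    then (mon0 mu == mon0 nu + U_(i))%MM%:R
    else if [pick a : 'I_(size (B1 n r)) | mon1 a == (mon0 nu + U_(i))%MM]
           is Some a then G mu a else 0.

Definition commuting (K : fieldType) (n r : nat) : set (gmatrix K n r) :=
  [set G | forall i j : 'I_n,
     mulmat G i *m mulmat G j = mulmat G j *m mulmat G i].

(* The discriminant of a monic polynomial p of degree k, namely
   (-1)^(k(k-1)/2) Res(p, p'). *)
Definition discr (K : fieldType) (p : {poly K}) : K :=
  (-1) ^+ 'C((size p).-1, 2) * resultant p p^`().

Definition dis (K : fieldType) (k : nat) (X : 'M[K]_k) : K :=
  discr (char_poly X).

Definition discr_locus (K : fieldType) (n r : nat) : set (gmatrix K n r) :=
  [set G | forall i : 'I_n, dis (mulmat G i) = 0].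

Definition phi_zeros (K : fieldType) (n r : nat) (G : gmatrix K n r) :
    set 'rV[K]_n :=
  [set v | forall a : 'I_(size (B1 n r)), (phi G a).@[v 0] = 0].

Definition nondefective (K : fieldType) (n r : nat) (G : gmatrix K n r) : Prop :=
  exists s : seq 'rV[K]_n, [/\ uniq s, size s = r & phi_zeros G = [set` s]].

(* Main.v *)
Require Import Defs.
From mathcomp Require Import all_boot all_order all_algebra perm separable.
From mathcomp Require Import boolp classical_sets reals.
From mathcomp Require Import complex mpoly.

Set Implicit Arguments.
Unset Strict Implicit.
Unset Printing Implicit Defensive.

Import Order.TTheory GRing.Theory Num.Theory.
Local Open Scope classical_set_scope.
Local Open Scope ring_scope.

(** Let M_i be the matrices of multiplication by the variables x_i, attached
    to a generating matrix G. A point v is a zero of phi[G] if and only if the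
    row of the values at v of the monomials of B0 is a common left eigenvector
    of the M_i, with eigenvalues the coordinates v_i (phi_zerosE). Conversely,
    a common left eigenvector w always has this shape up to its entry at the
    monomial 1: B0 is closed under division (B0_divisor), so every entry of w
    is reached from that one by multiplying by variables inside B0, and each
    multiplication scales by an eigenvalue (common_eigenvectorE). So the zeros
    of phi[G] are the common left eigenlines of the M_i.

    If G is commuting and outside the discriminant locus, some M_{i0} has no
    repeated eigenvalue. Its size is r, so it has r eigenvalues, whose
    eigenspaces are lines (simple_spectrum). As the M_i commute, they all
    preserve each of these lines. Hence there are exactly r common eigenlines, and the r zeros
    are told apart by their i0-th coordinate (commuting_nondefective).

    Both parts follow: the intersection with the discriminant locus is empty,
    so the given G is commuting and outside that locus. *)

(** * The graded lexicographic order and the set B0 *)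

Section Monomials.
Variable n : nat.
Implicit Types a b c : 'X_{1..n}.

Lemma grlex_lt_trans : transitive (@grlex_lt n).
Proof.
move=> b a c /orP[ab|/andP[/eqP ab /existsP[i /andP[iab /forallP eab]]]];
  move=> /orP[bc|/andP[/eqP bc /existsP[k /andP[kbc /forallP ebc]]]];
  rewrite /grlex_lt.
- by rewrite (ltn_trans ab bc).
- by rewrite -bc ab.
- by rewrite ab bc.
rewrite ab bc eqxx ltnn /=.
have eab' (j : 'I_n) : (j < i)%N -> a j = b j.
  by move=> ji; have := eab j; rewrite ji => /eqP.
have ebc' (j : 'I_n) : (j < k)%N -> b j = c j.
  by move=> jk; have := ebc j; rewrite jk => /eqP.
apply/existsP; case: (ltngtP i k) => ik.
- exists i; rewrite -(ebc' _ ik) iab; apply/forallP => j; apply/implyP => ji.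
  by rewrite eab' ?ebc' // (ltn_trans ji).
- exists k; rewrite (eab' _ ik) kbc; apply/forallP => j; apply/implyP => jk.
  by rewrite eab' ?ebc' // (ltn_trans jk).
- exists i; rewrite (ltn_trans _ iab) ?(ord_inj ik) //.
  apply/forallP => j; apply/implyP => jk.
  by rewrite eab' ?ebc' // ?(ord_inj ik).
Qed.

Lemma grlex_le_trans : transitive (@grlex_le n).
Proof.
move=> b a c /orP[/eqP -> //|ab] /orP[/eqP <-|bc]; rewrite /grlex_le.
  by rewrite ab orbT.
by rewrite (grlex_lt_trans ab bc) orbT.
Qed.

Lemma grlex_le_total : total (@grlex_le n).
Proof.
move=> a b; rewrite /grlex_le; have [//|ne] := eqVneq a b.
rewrite /grlex_lt; case: (ltngtP (mdeg a) (mdeg b)) => _ //=; rewrite ?orbT //.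
have [i0 hi0] : exists i, a i != b i.
  apply/existsP; apply: contraR ne; rewrite negb_exists => /forallP h.
  by apply/eqP/mnmP => i; apply/eqP; have := h i; rewrite negbK.
pose P := [pred i | a i != b i].
have [i hi mini] := @arg_minnP _ i0 P (@nat_of_ord n) hi0.
have eqlt (j : 'I_n) : (j < i)%N -> a j = b j.
  move=> ji; apply/eqP; apply: contraLR ji => hj.
  by rewrite -leqNgt; apply: mini.
move: hi; rewrite /= neq_ltn => /orP[lt|lt]; apply/orP; [right|left].
  apply/existsP; exists i; rewrite lt; apply/forallP => j.
  by apply/implyP => ji; rewrite eqlt.
apply/existsP; exists i; rewrite lt; apply/forallP => j.
by apply/implyP => ji; rewrite eqlt.
Qed.

Let lowdeg r := [seq bmnm x | x <- enum {: 'X_{1..n < r}}].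

Lemma mem_lowdeg r a : (a \in lowdeg r) = (mdeg a < r)%N.
Proof.
apply/mapP/idP => [[x _ ->]|h]; first exact: bmdeg.
by exists (BMultinom h) => //; rewrite mem_enum.
Qed.

Lemma uniq_lowdeg r : uniq (lowdeg r).
Proof. by rewrite map_inj_uniq ?enum_uniq //; apply: val_inj. Qed.

Lemma B0_uniq r : uniq (B0 n r).
Proof. by rewrite take_uniq // sort_uniq uniq_lowdeg. Qed.

(** B0 is an initial segment for the graded order, and dividing by a variable
    lowers the degree. *)
Lemma B0_divisor r a (i : 'I_n) : (a + U_(i))%MM \in B0 n r -> a \in B0 n r.
Proof.
rewrite /B0 -/(lowdeg r); set s := sort _ _ => h.
have bs := mem_take h; have ltb := index_ltn h.
have dlt : (mdeg a < mdeg (a + U_(i)))%N by rewrite mdegD mdeg1 addn1.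
have as_ : a \in s.
  move: bs; rewrite !mem_sort !mem_lowdeg; exact: ltn_trans.
rewrite in_take //; apply: leq_ltn_trans ltb; rewrite leqNgt.
apply/negP => /ltnW le.
have srt : sorted (@grlex_le n) s by apply: sort_sorted; apply: grlex_le_total.
have refl : reflexive (@grlex_le n) by move=> x; rewrite /grlex_le eqxx.
have := sorted_leq_index grlex_le_trans refl srt _ _ bs as_ le.
rewrite /grlex_le /grlex_lt ltnNge (ltnW dlt) /= (gtn_eqF dlt) /= orbF.
by move=> /eqP e; move: dlt; rewrite e ltnn.
Qed.

(** The powers of one variable already give r monomials of degree < r. *)
Lemma size_B0 r : (0 < n)%N -> size (B0 n r) = r.
Proof.
move=> n0; rewrite size_take size_sort -/(lowdeg r).
suff h : (r <= size (lowdeg r))%N.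
  by move: h; rewrite leq_eqVlt => /orP[/eqP <-|->//]; rewrite ltnn.
pose i := Ordinal n0.
pose t := [seq (U_(i) *+ k)%MM | k <- iota 0 r].
have -> : r = size t by rewrite size_map size_iota.
apply: uniq_leq_size.
  rewrite map_inj_uniq ?iota_uniq // => k l.
  move=> /(congr1 (fun a : 'X_{1..n} => a i)).
  by rewrite !mulmnE !mnm1E eqxx !mul1n.
move=> _ /mapP[k + ->]; rewrite mem_iota mem_lowdeg size_map size_iota.
by rewrite mdegMn mdeg1 mul1n.
Qed.

Lemma mnm_split a : a != 0%MM -> exists b (i : 'I_n), a = (b + U_(i))%MM.
Proof.
move=> ne; have [i ai] : exists i, (0 < a i)%N.
  apply/existsP; apply: contraR ne; rewrite negb_exists => /forallP h.
  by apply/eqP/mnmP => i; rewrite mnm0E; apply/eqP; rewrite eqn0Ngt h.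
exists (a - U_(i))%MM, i; apply/esym/submK/mnm_lepP => j.
by rewrite mnm1E; case: eqP => // <-.
Qed.

Lemma B0_0 r : (0 < n)%N -> (0 < r)%N -> 0%MM \in B0 n r.
Proof.
move=> n0 r0.
have descent k a : mdeg a = k -> a \in B0 n r -> 0%MM \in B0 n r.
  elim: k a => [|k IH] a; first by move/eqP; rewrite mdeg_eq0 => /eqP ->.
  move=> da aB; have /mnm_split[b [i ea]] : a != 0%MM by rewrite -mdeg_eq0 da.
  apply: (IH b); last by apply: (B0_divisor (i := i)); rewrite -ea.
  by apply: succn_inj; rewrite -da ea mdegD mdeg1 addn1.
apply: (descent _ (nth 0%MM (B0 n r) 0) (erefl _)).
by apply: mem_nth; rewrite size_B0.
Qed.

Lemma mem_mon0 r (mu : 'I_(size (B0 n r))) : mon0 mu \in B0 n r.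
Proof. exact: mem_nth. Qed.

Lemma mon0_inj r : injective (@mon0 n r).
Proof.
move=> mu nu /eqP; rewrite nth_uniq ?B0_uniq ?ltn_ord // => /eqP.
exact: ord_inj.
Qed.

Lemma mon0_surj r a : a \in B0 n r -> exists mu, @mon0 n r mu = a.
Proof.
move=> h; have lt : (index a (B0 n r) < size (B0 n r))%N by rewrite index_mem.
by exists (Ordinal lt); apply: nth_index.
Qed.

Lemma mem_B1 r a : a \in B1 n r ->
  exists i nu, a = (@mon0 n r nu + U_(i))%MM /\ a \notin B0 n r.
Proof.
rewrite mem_undup mem_filter mem_cat => /andP[aN /orP[h|]].
  by rewrite h in aN.
move=> /allpairsP[[i b] /= [_ hb ea]]; have [nu enu] := mon0_surj hb.
by exists i, nu; rewrite enu addmC.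
Qed.

Lemma mon1_inj r : injective (@mon1 n r).
Proof.
move=> k l /eqP; rewrite nth_uniq ?undup_uniq ?ltn_ord // => /eqP.
exact: ord_inj.
Qed.

Lemma mon1_surj r (nu : 'I_(size (B0 n r))) (i : 'I_n) :
  (mon0 nu + U_(i))%MM \notin B0 n r ->
  exists k, @mon1 n r k = (mon0 nu + U_(i))%MM.
Proof.
move=> h; set b := (_ + _)%MM in h *.
have bB : b \in B1 n r.
  rewrite mem_undup mem_filter h mem_cat; apply/orP; right.
  by apply/allpairsP; exists (i, mon0 nu); rewrite mem_enum mem_mon0 addmC.
have lt : (index b (B1 n r) < size (B1 n r))%N by rewrite index_mem.
by exists (Ordinal lt); apply: nth_index.
Qed.

End Monomials.

(** * Matrices with nonzero discriminant *)

Section Spectrum.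
Variables (K : closedFieldType) (k : nat) (X : 'M[K]_k).

Lemma dis_separable : dis X != 0 -> separable_poly (char_poly X).
Proof.
rewrite /dis /discr mulf_eq0 negb_or => /andP[_].
rewrite resultant_eq0 -leqNgt => h.
rewrite separable_poly.unlock /coprimep eqn_leq h lt0n size_poly_eq0 gcdp_eq0.
by rewrite negb_and monic_neq0 // char_poly_monic.
Qed.

(** The characteristic polynomial splits without repeated factor, so there are k
    distinct eigenvalues; their eigenspaces are nonzero and independent in a
    space of dimension k, so each of them is a line. *)
Lemma simple_spectrum : dis X != 0 ->
  exists s : seq K, [/\ uniq s, size s = k,
    forall a, (a \in s) = eigenvalue X a &
    forall a, (\rank (eigenspace X a) <= 1)%N].
Proof.
move=> /dis_separable sep.
have [s es] := closed_field_poly_normal (char_poly X).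
move: es; rewrite (monicP (char_poly_monic X)) scale1r => es.
have us : uniq s by rewrite -separable_prod_XsubC -es.
have ss : size s = k.
  by apply: succn_inj; rewrite -(size_char_poly X) es size_prod_XsubC.
have ms a : (a \in s) = eigenvalue X a.
  by rewrite eigenvalue_root_char es root_prod_XsubC.
exists s; split=> // a; have [as_|] := boolP (a \in s); last first.
  by rewrite ms negbK => /eqP ->; rewrite mxrank0.
pose l (i : 'I_(size s)) := s`_i.
have linj : {in predT &, injective l}.
  by move=> i j _ _ /eqP; rewrite nth_uniq // => /eqP /ord_inj.
have := mxdirectP (mxdirect_sum_eigenspace X linj).
rewrite /= => sumE.
have lt : (index a s < size s)%N by rewrite index_mem.
pose ia := Ordinal lt.
have la : l ia = a by apply: nth_index.
have := rank_leq_col (\sum_i eigenspace X (l i))%MS.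
rewrite sumE (bigD1 ia) //= la => le.
have : (\sum_(i < size s | i != ia) 1 <=
        \sum_(i < size s | i != ia) \rank (eigenspace X (l i)))%N.
  apply: leq_sum => i _; rewrite lt0n mxrank_eq0.
  by have := mem_nth 0 (ltn_ord i); rewrite ms.
rewrite sum1_card (cardC1 ia) card_ord => le2.
have s0 : (0 < size s)%N by exact: leq_ltn_trans (leq0n _) lt.
rewrite -(leq_add2r (size s).-1) add1n prednK // {2}ss.
by apply: leq_trans le; rewrite leq_add2l.
Qed.

Lemma eigenline_collinear a (u w : 'rV[K]_k) :
  (\rank (eigenspace X a) <= 1)%N -> w != 0 ->
  w *m X = a *: w -> u *m X = a *: u -> (u <= w)%MS.
Proof.
move=> line w0 /eigenspaceP wE /eigenspaceP uE; apply: submx_trans uE _.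
rewrite -(geq_leqif (mxrank_leqif_sup wE)).
by rewrite rank_rV w0.
Qed.

End Spectrum.

(** * Zeros of phi[G] as common eigenvectors *)

Section Zeros.
Variables (K : fieldType) (n r : nat) (G : gmatrix K n r).
Implicit Types v : 'rV[K]_n.

Definition monomial_row v : 'rV[K]_(size (B0 n r)) :=
  \row_mu 'X_[mon0 mu].@[v 0].

Lemma mevalXDU v a (i : 'I_n) :
  'X_[a + U_(i)].@[v 0] = v 0 i * 'X_[a].@[v 0] :> K.
Proof. by rewrite mpolyXD mevalM mevalXU mulrC. Qed.

Lemma meval_phi v a :
  (phi G a).@[v 0] = (monomial_row v *m G) 0 a - 'X_[mon1 a].@[v 0].
Proof.
rewrite /phi mevalB raddf_sum /= mxE; congr (_ - _).
by apply: eq_bigr => mu _; rewrite mevalZ mxE mulrC.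
Qed.

Lemma mulmx_mulmat_B0 (w : 'rV_(size (B0 n r))) (i : 'I_n) nu mu :
  mon0 mu = (mon0 nu + U_(i))%MM -> (w *m mulmat G i) 0 nu = w 0 mu.
Proof.
move=> e; rewrite mxE (bigD1 mu) //= mxE -e mem_mon0 eqxx mulr1.
rewrite big1 ?addr0 // => l ne; rewrite mxE -e mem_mon0.
by rewrite (inj_eq (@mon0_inj _ _)) (negbTE ne) mulr0.
Qed.

Lemma mulmx_mulmat_B1 (w : 'rV_(size (B0 n r))) (i : 'I_n) nu a :
  mon1 a = (mon0 nu + U_(i))%MM -> (mon0 nu + U_(i))%MM \notin B0 n r ->
  (w *m mulmat G i) 0 nu = (w *m G) 0 a.
Proof.
move=> e nB; rewrite !mxE; apply: eq_bigr => mu _; rewrite !mxE (negbTE nB).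
case: pickP => [b /eqP|/(_ a)]; last by rewrite e eqxx.
by rewrite -e => /mon1_inj ->.
Qed.

(** Compare the entries at nu of both sides. If x_i x^nu lies in B0, they agree
    for every v; otherwise x_i x^nu lies in B1, and they agree exactly when
    the corresponding polynomial of phi[G] vanishes at v. Every element of B1
    arises in this way, so these equations are all those of the zero locus. *)
Lemma phi_zerosE v :
  phi_zeros G v <->
  forall i, monomial_row v *m mulmat G i = v 0 i *: monomial_row v.
Proof.
split=> [z i|h a].
  apply/rowP => nu; rewrite [in RHS]mxE [in RHS]mxE -mevalXDU.
  have [/mon0_surj[mu e]|nB] := boolP ((mon0 nu + U_(i))%MM \in B0 n r).
    by rewrite (mulmx_mulmat_B0 _ e) mxE e.
  have [a ea] := mon1_surj nB.
  rewrite (mulmx_mulmat_B1 _ ea nB) -ea.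
  by have /eqP := z a; rewrite meval_phi subr_eq0 => /eqP.
have [i [nu [ea nB]]] := mem_B1 (mem_nth 0%MM (ltn_ord a)).
rewrite meval_phi; rewrite -/(mon1 a) in ea nB; rewrite ea in nB.
rewrite -(mulmx_mulmat_B1 _ ea nB) h ea mevalXDU !mxE.
exact: subrr.
Qed.

(** Since B0 is closed under division, each of its monomials is reached from 1
    inside B0 by multiplying by variables; this determines w from its entry
    at 1. *)
Lemma common_eigenvectorE v (w : 'rV_(size (B0 n r))) o :
  mon0 o = 0%MM ->
  (forall i, w *m mulmat G i = v 0 i *: w) -> w = w 0 o *: monomial_row v.
Proof.
move=> eo h; apply/rowP => mu; rewrite !mxE.
elim: {mu}(mdeg (mon0 mu)) {-2}mu (erefl (mdeg (mon0 mu))) => [|k IH] mu.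
  move/eqP; rewrite mdeg_eq0 -eo => /eqP /mon0_inj ->.
  by rewrite eo mpolyX0 meval1 mulr1.
move=> dmu; have /mnm_split[b [ i ] ] : mon0 mu != 0%MM by rewrite -mdeg_eq0 dmu.
move=> emu; have /mon0_surj[nu enu] : b \in B0 n r.
  by apply: (B0_divisor (i := i)); rewrite -emu mem_mon0.
rewrite -enu in emu.
rewrite -(mulmx_mulmat_B0 w emu) h mxE (IH nu); last first.
  by apply: succn_inj; rewrite -dmu emu mdegD mdeg1 addn1.
by rewrite emu mevalXDU mulrCA.
Qed.

End Zeros.

(** * Nondefectiveness *)

(** The M_i commute with M_{i0}, hence preserve its eigenspaces; these being
    lines, every eigenvector of M_{i0} is common to all the M_i. *)
Lemma commuting_nondefective (K : closedFieldType) (n r : nat)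
    (G : gmatrix K n r) (i0 : 'I_n) :
  (0 < r)%N -> commuting G -> dis (mulmat G i0) != 0 -> nondefective G.
Proof.
move=> r0 comm dis0; have n0 : (0 < n)%N by case: n i0 {G comm dis0} => [[]|].
have [o eo] := mon0_surj (B0_0 n0 r0).
have row_o (v : 'rV[K]_n) : monomial_row r v 0 o = 1.
  by rewrite mxE eo mpolyX0 meval1.
have [s [us ss ms line]] := simple_spectrum dis0.
(* an a-eigenvector w is common to all the matrices, and the eigenvalues that
   it has for them are the coordinates of the required zero *)
have zero_of a : a \in s -> exists v, phi_zeros G v /\ v 0 i0 = a.
  rewrite ms /eigenvalue => ne; pose w := nz_row (eigenspace (mulmat G i0) a).
  have w0 : w != 0 by rewrite nz_row_eq0.
  have wE : w *m mulmat G i0 = a *: w by apply/eigenspaceP/nz_row_sub.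
  have wline i : exists c, w *m mulmat G i = c *: w.
    apply/sub_rVP.
    apply: (eigenline_collinear (line a) w0 wE).
    by rewrite -mulmxA comm mulmxA wE scalemxAl.
  have [c cE] := choice wline.
  pose v : 'rV[K]_n := \row_i c i.
  have wv i : w *m mulmat G i = v 0 i *: w by rewrite cE mxE.
  have wmon := common_eigenvectorE eo wv.
  have wo : w 0 o != 0 by apply: contra_neq w0 => e; rewrite wmon e scale0r.
  exists v; split.
    apply/phi_zerosE => i; apply: (scalerI wo).
    by rewrite scalemxAl -wmon wv [in LHS]wmon !scalerA mulrC.
  have := wv i0; rewrite wE => /rowP/(_ o); rewrite !mxE => /(mulIf wo) e.
  by rewrite e.
(* two zeros with the same i0-th coordinate give two vectors of the same
   eigenline with the same entry 1 *)
have coord_inj v v' : phi_zeros G v -> phi_zeros G v' -> v 0 i0 = v' 0 i0 ->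
    v = v'.
  move=> /phi_zerosE z /phi_zerosE z' e.
  suff ev : monomial_row r v = monomial_row r v'.
    apply/rowP => i; have := z i; rewrite ev z' => /rowP/(_ o).
    by rewrite !mxE eo mpolyX0 !meval1 !mulr1.
  have /sub_rVP[c cE] : (monomial_row r v <= monomial_row r v')%MS.
    apply: (eigenline_collinear (line (v' 0 i0))) => //.
      by apply/eqP => /rowP/(_ o)/eqP; rewrite row_o mxE oner_eq0.
    by rewrite z e.
  have := cE => /rowP/(_ o); rewrite row_o mxE row_o mulr1 => c1.
  by rewrite cE -c1 scale1r.
have /choice[f fP] a :
    exists v, a \in s -> phi_zeros G v /\ v 0 i0 = a.
  have [/zero_of[v hv]|_] := boolP (a \in s); first by exists v.
  by exists 0.
exists (map f s); split.
- rewrite map_inj_in_uniq // => a b /fP[_ ea] /fP[_ eb] e.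
  by rewrite -ea -eb e.
- by rewrite size_map ss size_B0.
apply/seteqP; split=> v /=; last by move=> /mapP[a /fP[z _] ->].
move=> z; have vs : v 0 i0 \in s.
  rewrite ms; apply/eigenvalueP; exists (monomial_row r v).
    by move/phi_zerosE: z => /(_ i0).
  by apply/eqP => /rowP/(_ o)/eqP; rewrite row_o mxE oner_eq0.
apply/mapP; exists (v 0 i0) => //; have [zf ef] := fP _ vs.
exact: coord_inj.
Qed.

Theorem proposition3p10 (R : realType) (m n r : nat)
    (hm : (1 <= m)%N) (hn : (1 <= n)%N) (hr : (1 <= r)%N)
    (F : tensor R[i] m n) (hF : sigma r F)
    (d : int)
    (hd : d = (r * n.+1)%:Z - 1 - (zariski_dim (@sigma R[i] m n r))%:Z) :
  (d = 0 ->
     generating F `&` @commuting R[i] n r `&` @discr_locus R[i] n r = set0 ->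
     forall G : gmatrix R[i] n r,
       (generating F `&` @commuting R[i] n r) G -> nondefective G)
  /\
  (0 < d ->
     forall H : {vspace 'M[R[i]]_(size (B0 n r), size (B1 n r))},
       (\dim H)%:Z + d = (\dim {: 'M[R[i]]_(size (B0 n r), size (B1 n r))})%:Z ->
       generating F `&` @commuting R[i] n r `&` [set` H]
         `&` @discr_locus R[i] n r = set0 ->
       forall G : gmatrix R[i] n r,
         (generating F `&` @commuting R[i] n r `&` [set` H]) G ->
         nondefective G).
Proof.
have main (G : gmatrix R[i] n r) :
    commuting G -> ~ discr_locus G -> nondefective G.
  move=> comm /existsNP[ i /eqP]; exact: commuting_nondefective.
split=> [_ disj G [gen comm]|_ H _ disj G [[gen comm] GH]];
  apply: main => // locus; have : set0 G by rewrite -disj; split.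
all: by [].
Qed.
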